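(* Let $H$ be Hall's universal locally finite group. Then: (1) $Aut(H)$ embeds the symmetric group $Sym(\omega)$, i.e. there is an injective group homomorphism $Sym(\omega) \to Aut(H)$. (2) There is an infinite set $S \subseteq H$ such that every permutation of $S$ can be lifted to an automorphism of $H$, i.e. for every bijection $\sigma : S \to S$ there is $h \in Aut(H)$ with $h(s) = \sigma(s)$ for all $s \in S$.
   Context: Hall's universal locally finite group $H$ is the group, unique up to isomorphism, such that: (A) $H$ is countable; (B) $H$ is locally finite (every finitely generated subgroup is finite); (C) every finite group embeds into $H$; (D) any two isomorphic finite subgroups of $H$ are conjugate in $H$. $Aut(H)$ denotes the group of all automorphisms of $H$, and $Sym(\omega)$ the group of all permutations of the set $\omega$ of natural numbers. *)

(* Defs.v *)
From HB Require Import structures.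
From mathcomp Require Import all_boot fingroup.
From mathcomp Require Import boolp classical_sets functions cardinality.

Set Implicit Arguments.
Unset Strict Implicit.
Unset Printing Implicit Defensive.

Local Open Scope classical_set_scope.
Local Open Scope group_scope.

(* The symmetric group on an arbitrary type; the product is the usual
   composition of functions, (s * t) x = s (t x). Note that this is the
   opposite of the convention of perm.v for permutations of finite types. *)
Record Sym (T : Type) := MkSym {
  sym_fun :> T -> T;
  sym_bij : bijective sym_fun
}.

Section SymGroup.
Variable T : Type.
Implicit Types s t u : Sym T.

HB.instance Definition _ := gen_eqMixin (Sym T).
HB.instance Definition _ := gen_choiceMixin (Sym T).

Lemma symP s t : s =1 t -> s = t.
Proof.
case: s t => [f fb] [g gb] /= /funext fg; move: gb; rewrite -fg => gb.
by rewrite (Prop_irrelevance fb gb).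
Qed.

Lemma sym_inv_subproof s : exists g : T -> T, cancel s g /\ cancel g s.
Proof. by case: (sym_bij s) => g; exists g. Qed.

Definition sym_inv_fun s : T -> T := projT1 (cid (sym_inv_subproof s)).

Lemma sym_funK s : cancel s (sym_inv_fun s).
Proof. by rewrite /sym_inv_fun; case: cid => g []. Qed.

Lemma sym_inv_funK s : cancel (sym_inv_fun s) s.
Proof. by rewrite /sym_inv_fun; case: cid => g []. Qed.

Definition sym_one : Sym T := @MkSym T id (@inv_bij T id (fun=> erefl)).

Definition sym_mul s t : Sym T := MkSym (bij_comp (sym_bij s) (sym_bij t)).

Definition sym_inv s : Sym T :=
  MkSym (Bijective (sym_inv_funK s) (sym_funK s)).

Fact sym_mulA : associative sym_mul.
Proof. by move=> s t u; apply: symP. Qed.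

Fact sym_mul1 : left_id sym_one sym_mul.
Proof. by move=> s; apply: symP. Qed.

Fact sym_mulr1 : right_id sym_one sym_mul.
Proof. by move=> s; apply: symP. Qed.

Fact sym_mulV : left_inverse sym_one sym_inv sym_mul.
Proof. by move=> s; apply: symP => x /=; exact: sym_funK. Qed.

Fact sym_mulrV : right_inverse sym_one sym_inv sym_mul.
Proof. by move=> s; apply: symP => x /=; exact: sym_inv_funK. Qed.

HB.instance Definition _ := isGroup.Build (Sym T)
  sym_mulA sym_mul1 sym_mulr1 sym_mulV sym_mulrV.

End SymGroup.

Definition is_automorphism (H : groupType) : pred (Sym H) :=
  fun s => `[< {morph s : x y / x * y} >].

(* The automorphism group, as a subgroup of the symmetric group of the
   carrier. *)
Record Aut (H : groupType) := MkAut {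
  aut_sym :> Sym H;
  aut_morph : is_automorphism aut_sym
}.

Section AutGroup.
Variable H : groupType.

HB.instance Definition _ := [isSub for @aut_sym H].
HB.instance Definition _ := [Choice of Aut H by <:].

Fact automorphism_closed : group_closed (@is_automorphism H).
Proof.
split=> [|s t]; first by apply/asboolP.
move=> /asboolP sM /asboolP tM; apply/asboolP => x y /=.
rewrite -sM; congr (sym_fun s _); apply: (can_inj (sym_funK t)).
by rewrite tM !sym_inv_funK.
Qed.

HB.instance Definition _ :=
  SubChoice_isSubGroup.Build (Sym H) (@is_automorphism H) (Aut H)
    automorphism_closed.

End AutGroup.

Section Hall.
Variable H : groupType.
Implicit Types (A B X : set H).

Definition is_subgroup A : Prop := group_closed (mem A).

Definition generated_subgroup X : set H := smallest is_subgroup X.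

Definition locally_finite : Prop :=
  forall X, finite_set X -> finite_set (generated_subgroup X).

(* An isomorphism A -> B is given by a total function on H whose values
   outside A are irrelevant. *)
Definition isomorphic_subgroups A B : Prop :=
  exists f : H -> H, set_bij A B f /\ {in A &, {morph f : x y / x * y}}.

Definition conjugate_subgroups A B : Prop :=
  exists g : H, B = [set x ^ g | x in A].

Record is_hall_universal : Prop := IsHallUniversal {
  hall_countable : countable [set: H];
  hall_locally_finite : locally_finite;
  hall_embeds_finite : forall G : finGroupType,
    exists f : {multiplicative G -> H}, injective f;
  hall_conjugate : forall A B,
    is_subgroup A -> finite_set A -> is_subgroup B -> finite_set B ->
    isomorphic_subgroups A B -> conjugate_subgroups A B
}.

End Hall.

(* Main.v *)
From HB Require Import structures.
From mathcomp Require Import all_boot fingroup perm finmap generic_quotient.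
From mathcomp Require Import boolp classical_sets functions cardinality.
Require Import Defs.

Set Implicit Arguments.
Unset Strict Implicit.
Unset Printing Implicit Defensive.

Local Open Scope classical_set_scope.
Local Open Scope group_scope.

(** Both claims follow from a stronger one ([action_extends_to_hall]): whenever
    a group Gm acts on a countable locally finite group E, there is an embedding
    of E into Hall's group H along which the action of Gm extends to all of H.
    Take for E the finite sets of natural numbers under symmetric difference,
    with Gm the symmetric group of the natural numbers permuting the points. The
    images in H of the singletons form the infinite set S of (2), and an element
    of Sym(nat) that acts trivially on them is trivial, which gives (1).

    To extend an action, it suffices to embed E equivariantly into some copy of
    H on which Gm acts, so the work is to build Hall's group around E without
    making a choice that Gm could disturb. Call a group homogeneous if every
    isomorphism between two of its finite subgroups is induced by a conjugation.
    A countable, locally finite, homogeneous group that contains every finite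
    group is isomorphic to H ([back_and_forth]); that H itself is homogeneous,
    and not only conjugates isomorphic subgroups, comes from realizing the
    automorphisms of a finite subgroup inside a finite symmetric group that also
    embeds into H ([hall_homogeneous]). Starting from E * H, where Gm acts
    trivially on H so that all finite groups are there from the beginning, we
    form an increasing sequence of groups, each of which contains conjugating
    elements for all the partial isomorphisms of the previous one. The union of
    the sequence is homogeneous.

    The heart of the matter is a single step of this sequence. Let G be
    countable and locally finite. An isomorphism f between finite subgroups A
    and B of G is induced by a conjugation inside Sym(G), in which G sits by left
    translations: since A and B have equally many cosets in a finite subgroup F
    containing both, some permutation p of G satisfies p (a x) = f(a) p(x) and
    moreover p(x) lies in F x for all x ([partial_iso_bijection]). There is no
    canonical p, so all the choices are made at once: G acts on G * I, where I is
    the set of all functions s that select one such permutation for every f, and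
    f is realized by the permutation (x, s) |-> (s f x, s). As Gm acts on I too,
    the group generated by these permutations and by the translations carries an
    action of Gm. It is countable because its generators are, and it is locally
    finite because its elements have bounded displacement: finitely many of them
    preserve all the sets F x * {s} for one finite subgroup F, and act on each of
    them in one of finitely many ways ([displaces_in_finite]). *)

(** * Generated subgroups and local finiteness *)

Lemma countable_enum (T : choiceType) (X : set T) (x0 : T) : countable X ->
  exists e : nat -> T, forall x, X x -> exists n, e n = x.
Proof.
case/countable_injP => f finj.
exists (fun n => xget x0 [set x | X x /\ f x = n]) => x Xx; exists (f x).
case: xgetP => [y _ [Xy fxy]|/(_ x)]; last by case.
by apply: finj => //; exact: mem_set.
Qed.

Section Subgroups.
Variable G : groupType.
Implicit Types (A B X : set G).

Lemma is_subgroupP A : is_subgroup A <->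
  [/\ A 1, forall x y, A x -> A y -> A (x * y) & forall x, A x -> A x^-1].
Proof.
split=> [/[dup] gA [A1 _]|[A1 AM AV]].
  split=> [|x y /mem_set Ax /mem_set Ay|x /mem_set Ax]; apply: set_mem => //.
  - exact: (group_closedM gA).
  - exact: (group_closedV gA).
by split=> [|x y /set_mem Ax /set_mem Ay]; apply/mem_set; last exact/AM/AV.
Qed.

Lemma generated_is_subgroup X : is_subgroup (generated_subgroup X).
Proof.
apply/is_subgroupP; split=> [B [/is_subgroupP[] //]|x y gx gy B sB|x gx B sB].
- by have [/is_subgroupP[_ BM _] _] := sB; apply: BM; [apply: gx|apply: gy].
- by have [/is_subgroupP[_ _ BV] _] := sB; apply: BV; apply: gx.
Qed.

Lemma sub_generated X : X `<=` generated_subgroup X.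
Proof. exact: sub_gen_smallest. Qed.

Lemma generated_sub X B :
  is_subgroup B -> X `<=` B -> generated_subgroup X `<=` B.
Proof. exact: smallest_sub. Qed.

(** Left multiplication by an element of A is an injective map from A to itself,
    hence onto by finiteness, so it hits 1. *)
Lemma finite_submonoid_subgroup A : finite_set A -> A 1 ->
  (forall x y, A x -> A y -> A (x * y)) -> is_subgroup A.
Proof.
move=> finA A1 AM; apply/is_subgroupP; split=> // x Ax.
have [s As] := (finite_seqP A).1 finA.
have sP y : (y \in undup s) <-> A y by rewrite mem_undup As.
have us : uniq [seq x * y | y <- undup s].
  by rewrite map_inj_uniq ?undup_uniq//; apply: mulgI.
have ss : {subset [seq x * y | y <- undup s] <= undup s}.
  by move=> _ /mapP[y /sP Ay ->]; apply/sP/AM.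
(* The translate of A is contained in A and has as many elements. *)
have [|_ es] := uniq_min_size us ss; first by rewrite size_map.
have : 1 \in [seq x * y | y <- undup s] by rewrite es; apply/sP.
by case/mapP => y /sP Ay e1; rewrite (mulg1_eq (esym e1)).
Qed.

(** A generated subgroup is the set of values of the words in the generators and
    their inverses, and there are countably many words. *)
Lemma countable_generated X :
  countable X -> countable (generated_subgroup X).
Proof.
have [[x0 Xx0] cX|X0 _] := pselect (exists x, X x); last first.
  apply/finite_set_countable/(sub_finite_set _ (finite_set1 (1 : G))).
  apply: generated_sub => [|x Xx]; last by case: X0; exists x.
  apply: finite_submonoid_subgroup; [exact: finite_set1|by []|].
  by move=> x y /= -> ->; rewrite mulg1.
have [g gX] := countable_enum x0 cX.
pose lett (p : nat * bool) := if p.2 then g p.1 else (g p.1)^-1.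
pose word w := \prod_(p <- w) lett p.
have cr : countable (range word).
  by apply: (sub_countable (card_image_le _ _)); exact: countableP.
have wordD v w : word (v ++ w) = word v * word w by rewrite /word big_cat.
apply: sub_countable cr; apply: subset_card_le; apply: generated_sub.
  apply/is_subgroupP; split.
  - by exists [::]; rewrite // /word big_nil.
  - move=> _ _ [v _ <-] [w _ <-]; exists (v ++ w) => //.
  - move=> _ [w _ <-]; exists [seq (p.1, ~~ p.2) | p <- rev w] => //.
    elim: w => [|[n b] w IHw]; first by rewrite /word !big_nil invg1.
    rewrite rev_cons map_rcons -cats1 wordD IHw (wordD [:: (n, b)]) invgM.
    by congr (_ * _); rewrite /word !big_seq1 /lett /=; case: b; rewrite ?invgK.
move=> x /gX[n <-]; exists [:: (n, true)] => //.
by rewrite /word big_seq1.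
Qed.

Lemma locally_finiteP : locally_finite G <->
  forall X, finite_set X ->
    exists F, [/\ is_subgroup F, finite_set F & X `<=` F].
Proof.
split=> lfG X finX.
  exists (generated_subgroup X); split; last exact: sub_generated.
    exact: generated_is_subgroup.
  exact: lfG.
have [F [sF finF XF]] := lfG X finX.
by apply: sub_finite_set finF; apply: generated_sub.
Qed.

End Subgroups.

(** * Isomorphisms between finite subgroups *)

Section PartialIso.
Variables G H : groupType.
Implicit Types R : set (G * H).

(** A partial isomorphism is handled through its graph, a finite subgroup of
    G * H: extending it is then inclusion, and inverting it is transposition. *)
Record partial_iso R : Prop := PartialIso {
  piso_finite : finite_set R;
  piso_subgroup : is_subgroup R;
  piso_fun : forall y, R (1, y) -> y = 1;
  piso_inj : forall x, R (x, 1) -> x = 1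
}.

Variables (R : set (G * H)) (pR : partial_iso R).

Lemma piso1 : R (1, 1).
Proof. by have /is_subgroupP[] := piso_subgroup pR. Qed.

Lemma pisoM x y x' y' : R (x, y) -> R (x', y') -> R (x * x', y * y').
Proof. by have /is_subgroupP[_ RM _] := piso_subgroup pR; apply: RM. Qed.

Lemma pisoV x y : R (x, y) -> R (x^-1, y^-1).
Proof. by have /is_subgroupP[_ _] := piso_subgroup pR; apply. Qed.

Lemma piso_funP x y y' : R (x, y) -> R (x, y') -> y = y'.
Proof.
move=> Ry Ry'; apply/divg1_eq/(piso_fun pR).
by rewrite -(mulgV x); apply/pisoM/pisoV.
Qed.

Lemma piso_injP x x' y : R (x, y) -> R (x', y) -> x = x'.
Proof.
move=> Ry Ry'; apply/divg1_eq/(piso_inj pR).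
by rewrite -(mulgV y); apply/pisoM/pisoV.
Qed.

Lemma piso_dom_subgroup : is_subgroup (fst @` R).
Proof.
apply/is_subgroupP; split.
- by exists (1, 1) => //; exact: piso1.
- move=> _ _ [[x y] Rx <-] [[x' y'] Rx' <-].
  by exists (x * x', y * y') => //; exact: pisoM.
- by move=> _ [[x y] Rx <-]; exists (x^-1, y^-1) => //; exact: pisoV.
Qed.

Lemma piso_dom_finite : finite_set (fst @` R).
Proof. exact/finite_image/(piso_finite pR). Qed.

End PartialIso.

Definition transpose T U (R : set (T * U)) : set (U * T) :=
  [set p | R (p.2, p.1)].

Lemma partial_iso_transpose (G H : groupType) (R : set (G * H)) :
  partial_iso R -> partial_iso (transpose R).
Proof.
move=> pR; split=> [| |y|x]; [|apply/is_subgroupP; split| |].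
- have -> : transpose R = (fun p => (p.2, p.1)) @` R.
    apply/seteqP; split=> [[y x] Rp|_ [[x y] Rp <-] //].
    by exists (x, y).
  exact/finite_image/(piso_finite pR).
- exact: piso1 pR.
- by move=> [y x] [y' x']; apply: (pisoM pR).
- by move=> [y x]; apply: (pisoV pR).
- exact: (piso_inj pR).
- exact: (piso_fun pR).
Qed.

Definition homogeneous (G : groupType) : Prop :=
  forall R : set (G * G), partial_iso R ->
    exists g, forall x y, R (x, y) -> y = x ^ g.

Definition embeds_finite (G : groupType) : Prop :=
  forall K : finGroupType, exists f : {multiplicative K -> G}, injective f.

(** * Finite subgroups of Hall's group *)

Lemma multiplicativeJ (G H : groupType) (f : {multiplicative G -> H}) x y :
  f (x ^ y) = f x ^ f y.
Proof. by apply: (mulgI (f y)); rewrite -gmulfM -!conjgC gmulfM. Qed.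

Definition morph_on (G H : groupType) (A : set G) (f : G -> H) : Prop :=
  forall x y, A x -> A y -> f (x * y) = f x * f y.

Definition inj_on (T U : Type) (A : set T) (f : T -> U) : Prop :=
  forall x y, A x -> A y -> f x = f y -> x = y.

(** In the regular representation of A on itself, an automorphism of A is one
    of the permutations of A, and conjugating by it applies it. So the finite
    group K of all permutations of A contains A together with elements inducing
    every automorphism of A. *)
Lemma cayley (G : groupType) (A : set G) : is_subgroup A -> finite_set A ->
  exists (K : finGroupType) (c : G -> K), [/\ morph_on A c, inj_on A c &
    forall f : G -> G, (forall x, A x -> A (f x)) -> morph_on A f ->
      inj_on A f -> exists p, forall x, A x -> c (f x) = c x ^ p].
Proof.
move=> /is_subgroupP[A1 AM AV] finA; pose F := fset_set A.
have FP x : (x \in F) <-> A x by rewrite in_fset_set//; split=> [/set_mem|/mem_set].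
have val_A (x : F) : A (val x) by apply/FP/valP.
pose one : F := [` (FP 1).2 A1]%fset.
have induced_perm f : (forall x, A x -> A (f x)) -> inj_on A f ->
    exists p : {perm F}, forall x, val (p x) = f (val x).
  move=> Af fI; pose g (x : F) : F := insubd one (f (val x)).
  have gE x : val (g x) = f (val x) by rewrite insubdK//; apply/FP/Af.
  have gI : injective g.
    by move=> x y /(congr1 val); rewrite !gE => /fI/val_inj; apply.
  by exists (perm gI) => x; rewrite permE.
have /choice[c cE] : forall a, exists p : {perm F},
    A a -> forall x, val (p x) = val x * a.
  move=> a; have [Aa|nAa] := pselect (A a); last by exists 1.
  have [x Ax|x y _ _|p pE] := @induced_perm (fun x => x * a); first exact: AM.
    exact: mulIg.
  by exists p.
exists {perm F}, c; split.
- move=> x y Ax Ay; apply/permP => z; apply: val_inj.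
  by rewrite permM !cE// ?mulgA//; exact: AM.
- move=> x y Ax Ay /(congr1 (fun p : {perm F} => val (p one))).
  by rewrite !cE// !mul1g.
- move=> f Af fM fI; have [p pE] := induced_perm f Af fI.
  exists p => x Ax; apply: (mulgI p); rewrite -conjgC.
  apply/permP => z; apply: val_inj.
  by rewrite !permM cE ?pE ?cE ?fM//; exact: Af.
Qed.

(** [cayley] transported into a group that contains all finite groups. *)
Lemma finite_subgroup_embeds (G H : groupType) (A : set G) :
  embeds_finite H -> is_subgroup A -> finite_set A ->
  exists e : G -> H, [/\ morph_on A e, inj_on A e &
    forall f : G -> G, (forall x, A x -> A (f x)) -> morph_on A f ->
      inj_on A f -> exists h, forall x, A x -> e (f x) = e x ^ h].
Proof.
move=> embH sA finA; have [K [c [cM cI cJ]]] := cayley sA finA.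
have [i iI] := embH K; exists (i \o c); split.
- by move=> x y Ax Ay /=; rewrite cM// gmulfM.
- by move=> x y Ax Ay /iI; exact: cI.
- move=> f Af fM fI; have [p pE] := cJ f Af fM fI.
  by exists (i p) => x Ax; rewrite /= pE// multiplicativeJ.
Qed.

(** Let A and B be the domain and the range of an isomorphism f, and embed A
    into H by e as in [finite_subgroup_embeds]. The hypothesis on Hall groups
    conjugates e(A) to A and to B, but by isomorphisms that are not under
    control; they differ from f by an automorphism of A, and this one is a
    conjugation on e(A). *)
Lemma hall_homogeneous (H : groupType) : is_hall_universal H -> homogeneous H.
Proof.
move=> [_ _ embH conjH] R pR; pose A := fst @` R; pose B := fst @` transpose R.
have pR' := partial_iso_transpose pR.
have [sA finA] := (piso_dom_subgroup pR, piso_dom_finite pR).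
have [sB finB] := (piso_dom_subgroup pR', piso_dom_finite pR').
have /is_subgroupP[A1 AM AV] := sA.
have [e [eM eI eJ]] := finite_subgroup_embeds embH sA finA.
have e1 : e 1 = 1 by apply: (mulgI (e 1)); rewrite -eM// !mulg1.
have sE : is_subgroup (e @` A).
  apply: finite_submonoid_subgroup; [exact: finite_image|by exists 1|].
  by move=> _ _ [x Ax <-] [y Ay <-]; exists (x * y); [exact: AM|rewrite eM].
have finE : finite_set (e @` A) by exact: finite_image.
have [k Ek] : conjugate_subgroups A (e @` A).
  apply: conjH => //; exists e; split.
    split; first by move=> x Ax; exists x.
      by move=> x y /set_mem Ax /set_mem Ay; exact: eI.
    by [].
  by move=> x y /set_mem Ax /set_mem Ay; exact: eM.
have /choice[f fR] : forall x, exists y, A x -> R (x, y).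
  by move=> x; have [[[x' y] Rxy <-]|] := pselect (A x); by [exists y|exists 1].
have /choice[f' fR'] : forall y, exists x, B y -> R (x, y).
  by move=> y; have [[[y' x] Rxy <-]|] := pselect (B y); by [exists x|exists 1].
have RA x y : R (x, y) -> A x by exists (x, y).
have RB x y : R (x, y) -> B y by exists (y, x).
have [l El] : conjugate_subgroups B (e @` A).
  apply: conjH => //; exists (e \o f'); split.
    split.
    - by move=> y /fR'/RA Ay; exists (f' y).
    - move=> y y' /set_mem By /set_mem By' /= /eI-/(_ (RA _ _ (fR' _ By))).
      move=> /(_ (RA _ _ (fR' _ By'))) ff.
      by apply: (piso_funP pR (fR' _ By)); rewrite ff; exact: fR'.
    - move=> _ [x Ax <-]; exists (f x); first exact: (RB _ _ (fR _ Ax)).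
      by congr e; apply: (piso_injP pR (fR' _ (RB _ _ (fR _ Ax)))); exact: fR.
  move=> y y' /set_mem By /set_mem By' /=; rewrite -eM; first last.
  - exact: (RA _ _ (fR' _ By')).
  - exact: (RA _ _ (fR' _ By)).
  congr e; apply: (piso_injP pR (fR' _ _)); last by apply: (pisoM pR); exact: fR'.
  by have /is_subgroupP[_ BM _] := sB; exact: BM.
have kA a : A a -> A (e a ^ k^-1).
  move=> Aa; have : (e @` A) (e a) by exists a.
  by rewrite Ek => -[x Ax <-]; rewrite conjgK.
have fM : morph_on A f.
  move=> x y Ax Ay; apply: (piso_funP pR (fR _ _)); first exact: AM.
  by apply: (pisoM pR); exact: fR.
have fI : inj_on A f.
  by move=> x y Ax Ay fxy; apply: (piso_injP pR (fR _ Ax)); rewrite fxy; exact: fR.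
(* The automorphism of A that f becomes once its source and its target are
   both identified with A through e, k and l. *)
have /choice[g gP] : forall a, exists a', A a ->
    A a' /\ e a' = f (e a ^ k^-1) ^ l.
  move=> a; have [Aa|] := pselect (A a); last by exists 1.
  have : (e @` A) (f (e a ^ k^-1) ^ l).
    by rewrite El; exists (f (e a ^ k^-1)) => //; apply/RB/fR/kA.
  by case=> a' Aa' ea'; exists a'.
have [|x y Ax Ay|x y Ax Ay gxy|h hP] := eJ g.
- by move=> a /gP[].
- have [[Agx gx] [Agy gy]] := (gP x Ax, gP y Ay).
  have [Agxy gxy] := gP _ (AM _ _ Ax Ay).
  apply: eI; rewrite ?eM//; first exact: AM.
  by rewrite gxy gx gy -conjMg -fM ?eM ?conjMg//; exact: kA.
- have [[_ gx] [_ gy]] := (gP x Ax, gP y Ay).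
  move: gx; rewrite gxy gy => /conjg_inj/fI ff.
  by apply: eI => //; apply: (conjg_inj k^-1); apply/esym/ff; exact: kA.
exists (k * h * l^-1) => x y Rxy; have Ax := RA _ _ Rxy.
have [a Aa ea] : (e @` A) (x ^ k) by rewrite Ek; exists x.
rewrite (piso_funP pR Rxy (fR _ Ax)) !conjgM -ea -hP//.
by have [_ ->] := gP _ Aa; rewrite ea !conjgK.
Qed.

(** * Uniqueness by back and forth *)

Lemma graph_partial_iso (G H : groupType) (A : set G) (f : G -> H) :
  is_subgroup A -> finite_set A -> morph_on A f -> inj_on A f ->
  partial_iso [set p | A p.1 /\ p.2 = f p.1].
Proof.
move=> sA finA fM fI; have /is_subgroupP[A1 AM AV] := sA.
have f1 : f 1 = 1 by apply: (mulgI (f 1)); rewrite -fM// !mulg1.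
have finR : finite_set [set p | A p.1 /\ p.2 = f p.1].
  have -> : [set p | A p.1 /\ p.2 = f p.1] = (fun x => (x, f x)) @` A.
    by apply/seteqP; split=> [[x _] [/= Ax ->]|_ [x Ax <-]//]; exists x.
  exact: finite_image.
split=> // [|y [/= _ ->//]|x [/= Ax]].
- apply: finite_submonoid_subgroup => //= -[x _] [y _] [/= Ax ->] [/= Ay ->].
  by rewrite fM//; split=> //; exact: AM.
- by rewrite -f1 => /fI->.
Qed.

(** Embed in H some finite subgroup A containing x and the domain of R. The two
    copies in H of the domain of R, the one inside the image of A and the range
    of R, are identified by a conjugation; following the embedding of A by this
    conjugation gives a map that extends R. *)
Lemma partial_iso_extend (G H : groupType) (R : set (G * H)) (x : G) :
  locally_finite G -> homogeneous H -> embeds_finite H -> partial_iso R ->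
  exists R', [/\ partial_iso R', R `<=` R' & exists y, R' (x, y)].
Proof.
move=> /locally_finiteP lfG homH embH pR.
have [|A [sA finA xRA]] := lfG (x |` (fst @` R)).
  by rewrite finite_setU; split; [exact: finite_set1|exact: piso_dom_finite].
have Ax : A x by apply: xRA; left.
have RA a y : R (a, y) -> A a by move=> Ray; apply: xRA; right; exists (a, y).
have [e [eM eI _]] := finite_subgroup_embeds embH sA finA.
(* The isomorphism from the copy in e(A) of the domain of R to the range of R. *)
pose S := [set p : H * H | exists2 a, p.1 = e a & R (a, p.2)].
have /homH[g gP] : partial_iso S.
  have finS : finite_set S.
    have -> : S = (fun p => (e p.1, p.2)) @` R.
      apply/seteqP; split=> [[h y] [/= a -> Ra]|_ [[a y] Ra <-]].
        by exists (a, y).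
      by exists a.
    exact/finite_image/(piso_finite pR).
  have /is_subgroupP[A1 AM AV] := sA.
  have e1 : e 1 = 1 by apply: (mulgI (e 1)); rewrite -eM// !mulg1.
  split=> //.
  - apply: finite_submonoid_subgroup => //.
      by exists 1; rewrite ?e1//; exact: piso1 pR.
    move=> [_ y] [_ y'] [/= a -> Ra] [/= a' -> Ra']; exists (a * a') => /=.
      by rewrite eM//; [exact: RA Ra|exact: RA Ra'].
    exact: (pisoM pR).
  - move=> y [/= a ea Ra]; apply: (piso_fun pR).
    by rewrite (eI 1 a A1 (RA _ _ Ra)) // e1.
  - by move=> _ [/= a -> /(piso_inj pR)->]; rewrite e1.
exists [set p | A p.1 /\ p.2 = e p.1 ^ g]; split; last by exists (e x ^ g).
- apply: (graph_partial_iso (f := fun a => e a ^ g)) => //.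
    by move=> a b Aa Ab; rewrite eM// conjMg.
  by move=> a b Aa Ab /conjg_inj/eI; apply.
- move=> [a y] Ra; split; first exact: RA Ra.
  by apply: gP; exists a.
Qed.

(** The isomorphism is the union of a chain of partial isomorphisms; the n-th
    step puts the n-th element of G in the domain by [partial_iso_extend], and
    the n-th element of H in the range by the same lemma applied to the
    transposed relation. *)
Theorem back_and_forth (G H : groupType) :
  countable [set: G] -> locally_finite G -> homogeneous G -> embeds_finite G ->
  countable [set: H] -> locally_finite H -> homogeneous H -> embeds_finite H ->
  exists f : G -> H, bijective f /\ {morph f : x y / x * y}.
Proof.
move=> cG lfG homG embG cH lfH homH embH.
have [eG eGP] := countable_enum 1 cG; have [eH eHP] := countable_enum 1 cH.
have step (nR : nat * set (G * H)) : exists R', partial_iso nR.2 ->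
    [/\ partial_iso R', nR.2 `<=` R', exists y, R' (eG nR.1, y) &
      exists x, R' (x, eH nR.1)].
  case: nR => n R /=; have [pR|] := pselect (partial_iso R); last by exists R.
  have [R1 [pR1 RR1 [y R1y]]] := partial_iso_extend (eG n) lfG homH embH pR.
  have [R2 [pR2 RR2 [x R2x]]] :=
    partial_iso_extend (eH n) lfH homG embG (partial_iso_transpose pR1).
  exists (transpose R2) => _; split.
  - exact: partial_iso_transpose.
  - by move=> [a b] /RR1 R1ab; exact: (RR2 (b, a)).
  - by exists y; exact: (RR2 (_, _)).
  - by exists x.
have {step}[next nextP] := choice step.
pose R := fix R n := if n is m.+1 then next (m, R m) else [set (1, 1)].
have pR n : partial_iso (R n).
  elim: n => [|n /(nextP (n, _))[]//]; split=> [||y [//]|x [//]].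
    exact: finite_set1.
  apply: finite_submonoid_subgroup => //; first exact: finite_set1.
  by move=> _ _ /= -> ->; rewrite mulg1.
have subR m n : m <= n -> R m `<=` R n.
  move=> /subnK <-; elim: (n - m)%N => // k; rewrite addSn => /subset_trans; apply.
  by have [_ RR _ _] := nextP ((k + m)%N, _) (pR (k + m)%N).
have compat m n p q : R m p -> R n q -> exists k, R k p /\ R k q.
  move=> Rp Rq; exists (maxn m n).
  by split; [exact: (subR _ _ (leq_maxl m n))|exact: (subR _ _ (leq_maxr m n))].
have /choice[f fR] : forall x, exists y n, R n (x, y).
  move=> x; have [n <-] := eGP x Logic.I.
  by have [_ _ [y Rny] _] := nextP (n, _) (pR n); exists y, n.+1.
have /choice[g gR] : forall y, exists x n, R n (x, y).
  move=> y; have [n <-] := eHP y Logic.I.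
  by have [_ _ _ [x Rnx]] := nextP (n, _) (pR n); exists x, n.+1.
exists f; split.
  exists g => [x|y].
    have [[m Rm] [n Rn]] := (fR x, gR (f x)).
    by have [k [Rx Ry]] := compat _ _ _ _ Rm Rn; exact: (piso_injP (pR k) Ry Rx).
  have [[m Rm] [n Rn]] := (gR y, fR (g y)).
  by have [k [Rx Ry]] := compat _ _ _ _ Rm Rn; exact: (piso_funP (pR k) Ry Rx).
move=> x y; have [[m Rm] [n Rn]] := (fR x, fR y).
have [k [Rx Ry]] := compat _ _ _ _ Rm Rn; have [l Rl] := fR (x * y).
have [j [Rxy Rj]] := compat _ _ _ _ (pisoM (pR k) Rx Ry) Rl.
exact: (piso_funP (pR j) Rj Rxy).
Qed.

(** * Conjugating finite subgroups by permutations of bounded displacement *)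

Section CosetRepresentative.
Variables (G : groupType) (A : set G) (sA : is_subgroup A).

(** The representative of the coset A x; the canonical choice operator makes it
    depend on the coset alone. *)
Definition rep (x : G) : G := choose (fun y => `[< A (y / x) >]) x.

Lemma rep_div x : A (rep x / x).
Proof.
have /is_subgroupP[A1 _ _] := sA; apply/asboolP.
by apply: (@chooseP _ (fun y => `[< A (y / x) >])); apply/asboolP; rewrite mulgV.
Qed.

Lemma div_rep x : A (x / rep x).
Proof. by have /is_subgroupP[_ _ AV] := sA; rewrite -invgF; apply/AV/rep_div. Qed.

Lemma repM a x : A a -> rep (a * x) = rep x.
Proof.
have /is_subgroupP[A1 AM AV] := sA => Aa; rewrite /rep.
have e : (fun y => `[< A (y / (a * x)) >]) =1 (fun y => `[< A (y / x) >]).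
  move=> y; apply/asboolP/asboolP => [/AM/(_ Aa)|/AM/(_ (AV _ Aa))].
    by rewrite invgM mulgA mulgVK.
  by rewrite invgM mulgA.
rewrite (eq_choose e); apply: choose_id; apply/asboolP; first by rewrite mulgK.
by rewrite mulgV.
Qed.

Lemma repK x : rep (rep x) = rep x.
Proof. by rewrite -{1}(mulgVK x (rep x)) repM//; exact: rep_div. Qed.

End CosetRepresentative.

Section Glue.
Variable G : groupType.
Implicit Types (F A B : set G) (f tau : G -> G).

(** Every element of F is uniquely a product a * x with a in A and x a
    representative, which counts the cosets of A in F. *)
Lemma transversal_size F A (s sA : seq G) :
  is_subgroup F -> is_subgroup A -> A `<=` F ->
  uniq s -> (forall x, F x <-> x \in s) ->
  uniq sA -> (forall x, A x <-> x \in sA) ->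
  exists t : seq G, [/\ uniq t, forall x, x \in t <-> F x /\ rep A x = x &
    size s = (size sA * size t)%N].
Proof.
move=> /is_subgroupP[_ FM FV] gA AF us Fs uA As.
exists [seq x <- s | rep A x == x]; split.
- exact: filter_uniq.
- move=> x; rewrite mem_filter; split=> [/andP[/eqP xx /Fs]|[/Fs-> /eqP->]] //.
set t := [seq x <- s | _].
have tP x : x \in t -> F x /\ rep A x = x.
  by rewrite mem_filter => /andP[/eqP xx /Fs].
have -> : (size sA * size t)%N = size [seq a * x | a <- sA, x <- t].
  by rewrite size_allpairs.
apply/perm_size/uniq_perm => //.
  apply: allpairs_uniq => //; first exact: filter_uniq.
  move=> p q /allpairsP[[a x] /= [aA xt ->]] /allpairsP[[b y] /= [bA yt ->]] /=.
  have [[_ xx] [_ yy]] := (tP x xt, tP y yt).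
  have [Aa Ab] : A a /\ A b by split; apply/As.
  move=> /[dup] e /(congr1 (rep A)); rewrite !repM// xx yy => xy.
  by move: e; rewrite xy => /mulIg->.
move=> x; apply/idP/allpairsP => [xs|[[a y] /= [aA /tP[Fy _] ->]]]; last first.
  by apply/Fs/FM => //; apply/AF/As.
have Fx : F x by apply/Fs.
exists (x / rep A x, rep A x) => /=; split; last by rewrite mulgVK.
  by apply/As; exact: div_rep.
rewrite mem_filter repK// eqxx /=.
by apply/Fs; rewrite -(mulgVK x (rep A x)); apply: FM => //; apply: AF; exact: rep_div.
Qed.

(** Any x in G is uniquely a * t * r, where r represents the coset F x and t,
    in F, represents the coset A (x / r). Mapping a by f and t by tau while
    keeping r gives a map that is equivariant along f and preserves F x. *)
Definition glue F A f tau x :=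
  let r := rep F x in let t := rep A (x / r) in f (x / r / t) * tau t * r.

Lemma glueK F A B f f' tau tau' :
  is_subgroup F -> is_subgroup A -> is_subgroup B -> A `<=` F -> B `<=` F ->
  (forall a, A a -> B (f a) /\ f' (f a) = a) ->
  (forall t, F t -> rep A t = t ->
    [/\ F (tau t), rep B (tau t) = tau t & tau' (tau t) = t]) ->
  cancel (glue F A f tau) (glue F B f' tau').
Proof.
move=> gF gA gB AF BF fP tauP x; rewrite /glue /=.
have /is_subgroupP[_ FM FV] := gF.
set r := rep F x; set t := rep A (x / r).
have Fxr : F (x / r) by exact: div_rep.
have Ft : F t.
  by rewrite -(mulgVK (x / r) t); apply: FM => //; apply: AF; exact: rep_div.
have [Bf ff] := fP _ (div_rep gA (x / r)).
have [Ftau tau1 tau2] := tauP t Ft (repK gA _).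
have -> : rep F (f (x / r / t) * tau t * r) = r.
  by rewrite repM ?repK//; apply: FM => //; exact: BF.
by rewrite mulgK (repM gB _ Bf) tau1 mulgK ff tau2 !mulgVK.
Qed.

Lemma glueM F A f tau a x :
  is_subgroup F -> is_subgroup A -> A `<=` F -> morph_on A f -> A a ->
  glue F A f tau (a * x) = f a * glue F A f tau x.
Proof.
move=> gF gA AF fM Aa; rewrite /glue /= (repM gF _ (AF _ Aa)).
rewrite -[a * x / _]mulgA (repM gA _ Aa) -(mulgA a) (fM a)//; last exact: (div_rep gA).
by rewrite !mulgA.
Qed.

(** By [transversal_size] the domain and the range of R have equally many cosets
    in F. A bijection between the representatives makes [glue] invertible. *)
Lemma partial_iso_bijection (F : set G) (R : set (G * G)) :
  is_subgroup F -> finite_set F -> partial_iso R ->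
  (forall x y : G, R (x, y) -> F x /\ F y) ->
  exists p : Sym G, (forall x, F (p x / x)) /\
    forall x y z, R (x, y) -> p (x * z) = y * p z.
Proof.
move=> gF finF pR RF; have [sR0 Rs0] := (finite_seqP R).1 (piso_finite pR).
have [s0 Fs0] := (finite_seqP F).1 finF.
pose sR := undup sR0; pose s := undup s0.
have us : uniq s by exact: undup_uniq.
have Fs x : F x <-> x \in s by rewrite Fs0 mem_undup.
have Rs p : R p <-> p \in sR by rewrite Rs0 mem_undup.
pose A : set G := fst @` R; pose B : set G := fst @` transpose R.
have gA : is_subgroup A := piso_dom_subgroup pR.
have gB : is_subgroup B := piso_dom_subgroup (partial_iso_transpose pR).
have AF : A `<=` F by move=> _ [[x y] /RF[Fx _] <-].
have BF : B `<=` F by move=> _ [[y x] /RF[_ Fy] <-].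
have uA : uniq (map fst sR).
  rewrite map_inj_in_uniq ?undup_uniq// => -[x y] [x' y'] /= /Rs Rp /Rs Rq e.
  by rewrite -e in Rq *; rewrite (piso_funP pR Rp Rq).
have uB : uniq (map snd sR).
  rewrite map_inj_in_uniq ?undup_uniq// => -[x y] [x' y'] /= /Rs Rp /Rs Rq e.
  by rewrite -e in Rq *; rewrite (piso_injP pR Rp Rq).
have As x : A x <-> x \in map fst sR.
  split=> [[p Rp <-]|/mapP[p /Rs Rp ->]]; last by exists p.
  by apply/mapP; exists p => //; apply/Rs.
have Bs y : B y <-> y \in map snd sR.
  split=> [[[y' x] Rp <-]|/mapP[[x y'] /Rs Rp ->]]; last by exists (y', x).
  by apply/mapP; exists (x, y') => //; apply/Rs.
have [tA [utA tAP szA]] := transversal_size gF gA AF us Fs uA As.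
have [tB [utB tBP szB]] := transversal_size gF gB BF us Fs uB Bs.
have sR0' : 0 < size sR.
  by have /Rs := piso1 pR; rewrite -has_predT => R1; apply/hasP; exists (1, 1).
have szAB : size tA = size tB.
  by apply/eqP; rewrite -(eqn_pmul2l sR0') -{1}(size_map fst) -szA szB size_map.
have /choice[f fR] : forall x, exists y, A x -> R (x, y).
  by move=> x; have [[[x' y] Rxy <-]|] := pselect (A x); by [exists y|exists 1].
have /choice[f' fR'] : forall y, exists x, B y -> R (x, y).
  by move=> y; have [[[y' x] Rxy <-]|] := pselect (B y); by [exists x|exists 1].
have RA x y : R (x, y) -> A x by exists (x, y).
have RB x y : R (x, y) -> B y by exists (y, x).
pose tau t := nth 1 tB (index t tA); pose tau' t := nth 1 tA (index t tB).
have K1 : cancel (glue F A f tau) (glue F B f' tau').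
  apply: glueK => // [a Aa|t Ft tt].
    have Ba := RB _ _ (fR _ Aa); split=> //.
    exact: (piso_injP pR (fR' _ Ba) (fR _ Aa)).
  have tt' : t \in tA by apply/tAP.
  have : tau t \in tB by rewrite mem_nth// -szAB index_mem.
  move=> /[dup] /tBP[Ftau tau1] _; split=> //.
  by rewrite /tau' /tau index_uniq ?nth_index// -szAB index_mem.
have K2 : cancel (glue F B f' tau') (glue F A f tau).
  apply: glueK => // [b Bb|t Ft tt].
    have Ab := RA _ _ (fR' _ Bb); split=> //.
    exact: (piso_funP pR (fR _ Ab) (fR' _ Bb)).
  have tt' : t \in tB by apply/tBP.
  have : tau' t \in tA by rewrite mem_nth// szAB index_mem.
  move=> /[dup] /tAP[Ftau tau1] _; split=> //.
  by rewrite /tau' /tau index_uniq ?nth_index// szAB index_mem.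
have fM : morph_on A f.
  have /is_subgroupP[_ AM _] := gA.
  move=> x y Ax Ay; apply: (piso_funP pR (fR _ _)); first exact: AM.
  by apply: (pisoM pR); exact: fR.
exists (MkSym (Bijective K1 K2)) => /=; split=> [x|x y z Rxy].
  have /is_subgroupP[_ FM _] := gF; rewrite /glue /= -mulgA.
  apply: (FM); last exact: rep_div.
  set r := rep F x; have At := div_rep gA (x / r).
  apply: (FM); first exact/BF/(RB _ _ (fR _ At)).
  have tt : rep A (x / r) \in tA.
    apply/tAP; split; last exact: repK.
    rewrite -(mulgVK (x / r) (rep A (x / r))); apply: (FM); last exact: div_rep.
    by apply: AF; exact: rep_div.
  suff /tBP[] : tau (rep A (x / r)) \in tB by [].
  by rewrite mem_nth// -szAB index_mem.
rewrite glueM//; last exact: RA Rxy.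
by rewrite (piso_funP pR (fR _ (RA _ _ Rxy)) Rxy).
Qed.

End Glue.

(** * Local finiteness of groups of bounded displacement *)

Lemma symM T (s t : Sym T) x : (s * t) x = s (t x). Proof. by []. Qed.

Lemma symK T (s : Sym T) : cancel s (s^-1)%g.
Proof. by move=> x; rewrite -symM mulVg. Qed.

Lemma symKV T (s : Sym T) : cancel (s^-1)%g s.
Proof. by move=> x; rewrite -symM mulgV. Qed.

Section SubgroupType.
Variables (G : groupType) (A : set G) (gA : is_subgroup A).

(** The carrier does not mention the proof that A is a subgroup, but the group
    structure does: hence the two names. *)
Record subgroup_carrier := SubgroupCarrier {
  subgroup_val :> G;
  subgroup_valP : subgroup_val \in A
}.

HB.instance Definition _ := [isSub for subgroup_val].
HB.instance Definition _ := [Choice of subgroup_carrier by <:].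

Definition subgroup_type of is_subgroup A := subgroup_carrier.

HB.instance Definition _ := SubChoice.on (subgroup_type gA).
HB.instance Definition _ :=
  SubChoice_isSubGroup.Build G (mem A) (subgroup_type gA) gA.
End SubgroupType.

Section SubgroupTypeTheory.
Variables (G : groupType) (A : set G) (gA : is_subgroup A).

Lemma subgroup_type_countable :
  countable A -> countable [set: subgroup_type gA].
Proof.
case/countable_injP => f fI; apply/countable_injP.
exists (f \o val) => x y _ _ /= /fI; rewrite !subgroup_valP => /(_ isT isT).
exact: val_inj.
Qed.

Lemma subgroup_type_locally_finite :
  (forall X, X `<=` A -> finite_set X ->
    exists F, [/\ is_subgroup F, finite_set F & X `<=` F]) ->
  locally_finite (subgroup_type gA).
Proof.
move=> lfA; apply/locally_finiteP => X finX.
have [||F [gF finF XF]] := lfA (val @` X).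
- by move=> _ [x _ <-]; apply/set_mem/subgroup_valP.
- exact: finite_image.
exists (val @^-1` F); split.
- have /is_subgroupP[F1 FM FV] := gF; apply/is_subgroupP; split=> //=.
  by move=> x y; exact: FM.
  by move=> x; exact: FV.
- by apply: finite_preimage => // x y _ _; exact: val_inj.
- by move=> x Xx; apply: XF; exists x.
Qed.
End SubgroupTypeTheory.

Section BoundedDisplacement.
Variables (G : groupType) (I : Type).
Implicit Types (w : Sym (G * I)) (F : set G).

Definition displaces_in F w : Prop :=
  forall x c, exists2 z, F z & w (x, c) = (z * x, c).

(** Each set F r * {c} is preserved by the elements of X, and identified with F
    by z |-> z * r. Colour it with the way in which the finitely many elements
    of X then act on F: there are finitely many colours. The permutations whose
    action on such a set depends only on its colour form a monoid, which is
    finite because such a permutation amounts to a function from colours to maps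
    F -> F; a finite submonoid of a group is a subgroup. *)
Lemma displaces_in_finite F (X : set (Sym (G * I))) :
  is_subgroup F -> finite_set F -> finite_set X -> X `<=` displaces_in F ->
  exists M, [/\ is_subgroup M, finite_set M & X `<=` M].
Proof.
move=> gF finF /finite_seqP[s Xs] XF; have /is_subgroupP[F1 FM _] := gF.
pose E := fset_set F.
have EP x : (x \in E) <-> F x by rewrite in_fset_set//; split=> [/set_mem|/mem_set].
have FE (z : E) : F (val z) by apply/EP/valP.
pose toE : G -> E := insubd [` (EP 1).2 F1]%fset.
have toEK x : F x -> val (toE x) = x by move=> /EP Ex; rewrite insubdK.
(* The colour of the set F r * {c}. *)
pose col r c := [ffun p : 'I_(size s) * E =>
  toE ((nth 1 s p.1 (val p.2 * r, c)).1 / r)].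
pose follows (th : {ffun {ffun 'I_(size s) * E -> E} * E -> E}) w :=
  forall (z : E) r c, rep F r = r ->
    w (val z * r, c) = (val (th (col r c, z)) * r, c).
have follows_inj th w w' : follows th w -> follows th w' -> w = w'.
  move=> fw fw'; apply: symP => -[x c].
  rewrite -(mulgVK (rep F x) x) -(toEK _ (div_rep gF x)).
  by rewrite fw ?fw' ?repK.
pose M := [set w | exists th, follows th w]; exists M.
have finM : finite_set M.
  apply: (@sub_finite_set _ _ ((fun th => xget 1 (follows th)) @` setT)).
    move=> w [th fw]; exists th => //.
    by apply: (follows_inj th _ _ _ fw); apply: xgetPex; exists w.
  by apply: finite_image; exact: finite_finset.
split=> //.
  apply: finite_submonoid_subgroup => //.
    by exists [ffun q => q.2] => z r c _; rewrite ffunE.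
  move=> w w' [th fw] [th' fw'].
  exists [ffun q => th (q.1, th' (q.1, q.2))] => z r c rr.
  by rewrite symM fw'// fw// ffunE.
move=> w Xw; have ws : w \in s by have := Xw; rewrite Xs.
have is_ : index w s < size s by rewrite index_mem.
(* A colour records the action of every element of X, in particular of w. *)
exists [ffun q : {ffun 'I_(size s) * E -> E} * E => q.1 (Ordinal is_, q.2)] => z r c rr.
rewrite !ffunE /= nth_index//; have [y Fy ->] := XF w Xw (val z * r) c.
by rewrite /= !mulgA mulgK toEK//; exact: (FM _ _ Fy (FE z)).
Qed.

End BoundedDisplacement.

(** * Adjoining conjugating elements equivariantly *)

Record is_action (Gm G : groupType) (act : Gm -> G -> G) : Prop := IsAction {
  act1 : forall x, act 1 x = x;
  actM : forall c d x, act (c * d) x = act c (act d x);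
  act_morph : forall c, {morph act c : x y / x * y}
}.

Record lf_action (Gm : groupType) := LfAction {
  lf_group :> groupType;
  lf_act : Gm -> lf_group -> lf_group;
  lf_actP : is_action lf_act;
  lf_countable : countable [set: lf_group];
  lf_locally_finite : locally_finite lf_group
}.

Section Action.
Variables (Gm G : groupType) (act : Gm -> G -> G) (actP : is_action act).

Lemma actK c : cancel (act c) (act c^-1).
Proof. by move=> x; rewrite -(actM actP) mulVg (act1 actP). Qed.

Lemma actKV c : cancel (act c^-1) (act c).
Proof. by move=> x; rewrite -(actM actP) mulgV (act1 actP). Qed.

Lemma act_1 c : act c 1 = 1.
Proof. by apply: (mulgI (act c 1)); rewrite -(act_morph actP) !mulg1. Qed.

Lemma act_inv c x : act c x^-1 = (act c x)^-1.
Proof.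
by apply: (mulgI (act c x)); rewrite -(act_morph actP) !mulgV act_1.
Qed.

Lemma preimage_is_subgroup c (A : set G) :
  is_subgroup A -> is_subgroup (act c @^-1` A).
Proof.
move=> /is_subgroupP[A1 AM AV]; apply/is_subgroupP; split=> /=.
- by rewrite act_1.
- by move=> x y Ax Ay; rewrite (act_morph actP); exact: AM.
- by move=> x Ax; rewrite act_inv; exact: AV.
Qed.

Definition act_sym c : Sym G := MkSym (Bijective (actK c) (actKV c)).

Lemma act_symM c d : act_sym (c * d) = act_sym c * act_sym d.
Proof. by apply: symP => x /=; rewrite (actM actP). Qed.

Lemma act_symV c : act_sym c^-1 = (act_sym c)^-1.
Proof.
by apply/esym/mulg1_eq; rewrite -act_symM mulgV; apply: symP => x /=; exact: act1.
Qed.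

End Action.

Section ConjugatorExtension.
Variables (Gm : groupType) (E : lf_action Gm).
Local Notation G := (lf_group E).
Local Notation act := (@lf_act Gm E).
Let aP := lf_actP E.
Local Notation pairs := (seq (G * G)).

Definition entries (f : pairs) : set G :=
  generated_subgroup [set x | x \in map fst f ++ map snd f].

(** The first condition bounds the displacement of p by the finite subgroup
    generated by the entries of f, and so does not depend on a choice; this is
    what makes the notion invariant under automorphisms of G. *)
Definition realizes (f : pairs) (p : Sym G) : Prop :=
  (forall x, entries f (p x / x)) /\
  forall x y z, (x, y) \in f -> p (x * z) = y * p z.

Definition realizable (f : pairs) : Prop := exists p, realizes f p.

(** Selectors are what makes the construction canonical: no permutation realizing
    f is preferred, as all of them occur among the values of the selectors. *)
Record selector := Selector {
  sel :> pairs -> Sym G;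
  selP : forall f, realizable f -> realizes f (sel f)
}.

Lemma selector_ext (s t : selector) : sel s =1 sel t -> s = t.
Proof.
case: s t => [s sP] [t tP] /= /funext st; rewrite st in sP *.
by congr Selector; exact: Prop_irrelevance.
Qed.

Lemma selector_exists : exists s : selector, True.
Proof.
have /choice[s sP] (f : pairs) : exists p, realizable f -> realizes f p.
  by have [[p]|] := pselect (realizable f); [exists p|exists 1].
by exists (Selector sP).
Qed.

Definition act_pairs c (f : pairs) : pairs :=
  [seq (act c p.1, act c p.2) | p <- f].

Lemma act_pairsM c d f : act_pairs (c * d) f = act_pairs c (act_pairs d f).
Proof.
by rewrite /act_pairs -map_comp; apply: eq_map => p /=; rewrite !(actM aP).
Qed.

Lemma act_pairsK c : cancel (act_pairs c) (act_pairs c^-1).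
Proof.
move=> f; rewrite -act_pairsM mulVg -[RHS]map_id; apply: eq_map => -[x y] /=.
by rewrite !(act1 aP).
Qed.

Lemma act_pairsKV c : cancel (act_pairs c^-1) (act_pairs c).
Proof. by move=> f; rewrite -{1}(invgK c) act_pairsK. Qed.

Lemma conj_act_symE c (p : Sym G) x :
  (p ^ act_sym aP c^-1) x = act c (p (act c^-1 x)).
Proof. by rewrite conjgE -act_symV invgK. Qed.

Lemma realizes_act c f p :
  realizes f p -> realizes (act_pairs c f) (p ^ act_sym aP c^-1).
Proof.
case=> pf pM; split=> [x|x y z]; rewrite !conj_act_symE; last first.
  case/mapP=> -[a b] /= abf [-> ->].
  by rewrite (act_morph aP c^-1) (actK aP) (pM _ _ _ abf) (act_morph aP).
have : entries f `<=` act c @^-1` entries (act_pairs c f).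
  apply: generated_sub.
    exact/(preimage_is_subgroup aP)/generated_is_subgroup.
  move=> y; rewrite /= mem_cat => yf; apply: sub_generated => /=.
  rewrite -!map_comp mem_cat; apply/orP.
  by case/orP: yf => /mapP[q qf ->]; [left|right]; apply/mapP; exists q.
move=> /(_ _ (pf (act c^-1 x))) /=.
by rewrite (act_morph aP) (act_inv aP) (actKV aP).
Qed.

Lemma act_selector_subproof c (s : selector) f : realizable f ->
  realizes f (s (act_pairs c^-1 f) ^ act_sym aP c^-1).
Proof.
move=> [p pf]; rewrite -{1}(act_pairsKV c f); apply/realizes_act/selP.
by eexists; apply: realizes_act; exact: pf.
Qed.

Definition act_selector c (s : selector) : selector :=
  Selector (@act_selector_subproof c s).

Lemma act_selectorM c d s :
  act_selector (c * d) s = act_selector c (act_selector d s).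
Proof.
by apply: selector_ext => f /=; rewrite invgM act_pairsM act_symM conjgM.
Qed.

Lemma act_selector1 s : act_selector 1 s = s.
Proof.
apply: selector_ext => f /=; rewrite invg1.
have -> : act_sym aP 1 = 1 by apply: symP => x /=; rewrite (act1 aP).
rewrite conjg1; congr (sel s); rewrite -[RHS]map_id.
by apply: eq_map => -[x y] /=; rewrite !(act1 aP).
Qed.

Local Notation space := (G * selector)%type.

Lemma act_space_can c : cancel
  (fun p : space => (act c p.1, act_selector c p.2))
  (fun p : space => (act c^-1 p.1, act_selector c^-1 p.2)).
Proof.
by move=> [x s] /=; rewrite (actK aP) -act_selectorM mulVg act_selector1.
Qed.

Lemma act_space_canV c : cancel
  (fun p : space => (act c^-1 p.1, act_selector c^-1 p.2))
  (fun p : space => (act c p.1, act_selector c p.2)).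
Proof.
by move=> [x s] /=; rewrite (actKV aP) -act_selectorM mulgV act_selector1.
Qed.

Definition act_space c : Sym space :=
  MkSym (Bijective (act_space_can c) (act_space_canV c)).

Lemma act_spaceM c d : act_space (c * d) = act_space c * act_space d.
Proof.
by apply: symP => -[x s] /=; rewrite (actM aP) act_selectorM.
Qed.

Lemma act_space1 : act_space 1 = 1.
Proof. by apply: symP => -[x s] /=; rewrite (act1 aP) act_selector1. Qed.

Lemma trans_can g : cancel
  (fun p : space => (g * p.1, p.2)) (fun p : space => (g^-1 * p.1, p.2)).
Proof. by move=> [x s] /=; rewrite mulKg. Qed.

Lemma trans_canV g : cancel
  (fun p : space => (g^-1 * p.1, p.2)) (fun p : space => (g * p.1, p.2)).
Proof. by move=> [x s] /=; rewrite mulVKg. Qed.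

Definition trans g : Sym space := MkSym (Bijective (trans_can g) (trans_canV g)).

Lemma conj_can f : cancel
  (fun p : space => (p.2 f p.1, p.2))
  (fun p : space => (((p.2 f)^-1 : Sym G) p.1, p.2)).
Proof. by move=> [x s] /=; rewrite sym_funK. Qed.

Lemma conj_canV f : cancel
  (fun p : space => (((p.2 f)^-1 : Sym G) p.1, p.2))
  (fun p : space => (p.2 f p.1, p.2)).
Proof. by move=> [x s] /=; rewrite sym_inv_funK. Qed.

(** Inside the fibre of a selector c, conjugating by this permutation is
    conjugating by the permutation that c selects for f. *)
Definition conjugator f : Sym space :=
  MkSym (Bijective (conj_can f) (conj_canV f)).

Lemma transM g h : trans (g * h) = trans g * trans h.
Proof. by apply: symP => -[x s] /=; rewrite mulgA. Qed.

Lemma trans_act c g : trans (act c g) = trans g ^ (act_space c)^-1.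
Proof.
apply: (mulIg (act_space c)); rewrite conjgE invgK mulgA mulgVK.
by apply: symP => -[x s] /=; rewrite (act_morph aP).
Qed.

(** The conjugators are permuted by Gm: this is what fails for the permutations
    of G that realize f when one of them is fixed by a choice. *)
Lemma conjugator_act c f :
  conjugator (act_pairs c f) = conjugator f ^ (act_space c)^-1.
Proof.
apply: (mulIg (act_space c)); rewrite conjgE invgK mulgA mulgVK.
apply: symP => -[x s]; rewrite !symM.
pose q := s (act_pairs c^-1 (act_pairs c f)) ^ act_sym aP c^-1.
transitivity (q (act c x), act_selector c s); first by [].
by rewrite conj_act_symE act_pairsK actK.
Qed.

Lemma trans_conjugator f x y : realizable f -> (x, y) \in f ->
  trans y = trans x ^ (conjugator f)^-1.
Proof.
move=> rf xyf; apply: (mulIg (conjugator f)); rewrite conjgE invgK mulgA mulgVK.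
by apply: symP => -[z s] /=; have [_ /(_ _ _ _ xyf)->] := selP s rf.
Qed.

Definition generators : set (Sym space) :=
  range trans `|` (conjugator @` realizable).

Definition extension_set := generated_subgroup generators.

Let gK : is_subgroup extension_set := generated_is_subgroup generators.

Definition extension_group : groupType := subgroup_type gK.

(** Gm acts by conjugation, and permutes the generators by [trans_act] and
    [conjugator_act]. *)
Lemma act_space_conj c w :
  extension_set w -> extension_set (w ^ (act_space c)^-1).
Proof.
have /is_subgroupP[K1 KM KV] := gK.
suff : extension_set `<=` [set v | extension_set (v ^ (act_space c)^-1)].
  by apply.
apply: generated_sub.
  apply/is_subgroupP; split=> /= [|v v'|v]; rewrite ?conj1g ?conjMg ?conjVg//.
    exact: KM.
  exact: KV.
move=> _ [[g _ <-]|[f rf <-]]; apply: sub_generated.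
  by left; exists (act c g); rewrite // trans_act.
right; exists (act_pairs c f); last exact: conjugator_act.
by case: rf => p pf; eexists; apply: realizes_act pf.
Qed.

Definition extension_act c (k : extension_group) : extension_group :=
  SubgroupCarrier (mem_set (act_space_conj c (set_mem (subgroup_valP k)))).

Lemma extension_actP : is_action extension_act.
Proof.
split=> [k|c d k|c k l]; apply: val_inj => /=.
- by rewrite act_space1 invg1 conjg1.
- by rewrite act_spaceM invgM conjgM.
- exact: conjMg.
Qed.

Lemma extension_countable : countable [set: extension_group].
Proof.
apply/subgroup_type_countable/countable_generated.
have cG := lf_countable E; rewrite /generators.
have cpairs : countable [set: pairs].
  have /countable_injP[n nI] := cG; apply/countable_injP.
  have {}nI : injective n by move=> x y; apply: nI; rewrite inE.
  exists (fun f : pairs => @choice.pickle (seq (nat * nat)) [seq (n p.1, n p.2) | p <- f]) => f g _ _.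
  move=> /(pcan_inj choice.pickleK)/inj_map; apply=> -[x y] [x' y'] /= [].
  by move=> /nI-> /nI->.
rewrite -bigcup2E; apply: bigcup_countable => // -[|[|i]] _ /=.
- by apply: sub_countable cG; exact: card_image_le.
- apply: sub_countable cpairs; apply: card_le_trans (card_image_le _ _) _.
  exact: subset_card_le.
- exact: countable0.
Qed.

(** The permutations of finite displacement form a group. A translation by g has
    displacement g, and the displacement of the conjugator of f is bounded
    uniformly over all selectors by the subgroup generated by the entries of f. *)
Lemma extension_displaces w : extension_set w ->
  exists F, [/\ is_subgroup F, finite_set F & displaces_in F w].
Proof.
have /locally_finiteP lfG := @lf_locally_finite _ E.
pose D := [set w : Sym space | exists F,
  [/\ is_subgroup F, finite_set F & displaces_in F w]].
have DX X v : finite_set X -> displaces_in X v -> D v.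
  move=> /lfG[F [gF finF XF]] vX; exists F; split=> // x c.
  by have [z /XF Fz ->] := vX x c; exists z.
suff : extension_set `<=` D by apply.
apply: generated_sub => [|_ [[g _ <-]|[f rf <-]]].
- apply/is_subgroupP; split=> [|v v'|v].
  + apply: (DX [set 1]); first exact: finite_set1.
    by move=> x c; exists 1; rewrite // mul1g.
  + move=> [F [_ finF vF]] [F' [_ finF' vF']].
    have [|F2 [gF2 finF2 FF]] := lfG (F `|` F'); first by rewrite finite_setU.
    have /is_subgroupP[_ FM _] := gF2; exists F2; split=> // x c.
    have [z' Fz' e'] := vF' x c; have [z Fz e] := vF (z' * x) c.
    exists (z * z'); last by rewrite symM e' e mulgA.
    by apply: FM; apply: FF; [left|right].
  + move=> [F [gF finF vF]]; exists F; split=> // x c.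
    have /is_subgroupP[_ _ FV] := gF.
    have := symKV v (x, c); case: ((v^-1)%g (x, c)) => y d.
    have [z Fz ->] := vF y d => -[<- <-]; exists z^-1; first exact: FV.
    by rewrite mulKg.
- apply: (DX [set g]); first exact: finite_set1.
  by move=> x c; exists g.
- apply: (DX (entries f)).
    apply: (@lf_locally_finite _ E).
    exact: finite_seq.
  move=> x c; have [cf _] := selP c rf; exists (c f x / x) => //=.
  by rewrite mulgVK.
Qed.

Lemma extension_locally_finite : locally_finite extension_group.
Proof.
apply: subgroup_type_locally_finite => X XK finX.
have /choice[F_ F_P] : forall w, exists F, extension_set w ->
    [/\ is_subgroup F, finite_set F & displaces_in F w].
  move=> w; have [/extension_displaces[F]|] := pselect (extension_set w).
    by exists F.
  by exists set0.
have /locally_finiteP lfG := @lf_locally_finite _ E.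
have [|F [gF finF XF]] := lfG (\bigcup_(w in X) F_ w).
  by apply: bigcup_finite => // w /XK/F_P[].
apply: (displaces_in_finite gF finF finX) => w Xw x c.
have [_ _ /(_ x c)[z Fz ->]] := F_P w (XK _ Xw).
by exists z => //; apply: XF; exists w.
Qed.

Definition extension : lf_action Gm :=
  LfAction extension_actP extension_countable extension_locally_finite.

Lemma trans_in g : trans g \in extension_set.
Proof. by apply/mem_set; apply: sub_generated; left; exists g. Qed.

Definition extension_embed g : extension := SubgroupCarrier (trans_in g).

Lemma extension_embedM : {morph extension_embed : x y / x * y}.
Proof. by move=> x y; apply: val_inj => /=; exact: transM. Qed.

Lemma extension_embed_inj : injective extension_embed.
Proof.
move=> x y /(congr1 val) /= e; have [s _] := selector_exists.
have := congr1 (fun w : Sym space => (w (1, s)).1) e.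
by rewrite /= !mulg1.
Qed.

Lemma extension_embed_act c x :
  extension_embed (act c x) = lf_act c (extension_embed x).
Proof. by apply: val_inj; exact: trans_act. Qed.

Lemma extension_embed_conj (R : set (G * G)) : partial_iso R ->
  exists t, forall x y, R (x, y) -> extension_embed y = extension_embed x ^ t.
Proof.
move=> pR; have [f Rf] := (finite_seqP R).1 (piso_finite pR).
have rf : realizable f.
  have finF : finite_set (entries f).
    apply: (@lf_locally_finite _ E).
    exact: finite_seq.
  have [|p pP] := partial_iso_bijection (generated_is_subgroup _) finF pR.
    move=> x y; rewrite Rf => xyf; split; apply: sub_generated.
      by rewrite /= mem_cat; apply/orP; left; apply/mapP; exists (x, y).
    by rewrite /= mem_cat; apply/orP; right; apply/mapP; exists (x, y).
  exists p; split; first by case: pP.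
  by move=> x y z xyf; case: pP => _; apply; rewrite Rf.
have tK : conjugator f \in extension_set.
  by apply/mem_set; apply: sub_generated; right; exists f.
exists (SubgroupCarrier tK : extension_group)^-1 => x y; rewrite Rf => xyf.
by apply: val_inj; exact: (trans_conjugator rf).
Qed.

End ConjugatorExtension.

(** * The union of an increasing sequence of groups *)

Section ReducedProduct.
Variable T : nat -> groupType.

(** The union of an increasing sequence of embeddings is realized inside the
    product of the groups modulo eventual equality, as the germs of the
    sequences that eventually follow the embeddings: this avoids transporting
    elements along equalities between indices. *)
Definition sequences : Type := forall n, T n.

HB.instance Definition _ := gen_eqMixin sequences.
HB.instance Definition _ := gen_choiceMixin sequences.

Implicit Types s t : sequences.

Definition eventually_eq s t : bool :=
  `[< exists N, forall n, N <= n -> s n = t n >].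

Lemma eventually_eq_refl : reflexive eventually_eq.
Proof. by move=> s; apply/asboolP; exists 0. Qed.

Lemma eventually_eq_sym : symmetric eventually_eq.
Proof.
by move=> s t; apply/asboolP/asboolP => -[N e]; exists N => n /e.
Qed.

Lemma eventually_eq_trans : transitive eventually_eq.
Proof.
move=> t s u /asboolP[M e] /asboolP[N e']; apply/asboolP.
by exists (maxn M N) => n; rewrite geq_max => /andP[/e-> /e'].
Qed.

Canonical eventually_equiv := EquivRel eventually_eq
  eventually_eq_refl eventually_eq_sym eventually_eq_trans.

Definition reduced_product := {eq_quot eventually_equiv}%qT.

HB.instance Definition _ := Choice.on reduced_product.

Definition germ s : reduced_product := (\pi s)%qT.

Lemma germP s t :
  germ s = germ t <-> exists N, forall n, N <= n -> s n = t n.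
Proof. by split=> [/eqmodP/asboolP|h]; last exact/eqmodP/asboolP. Qed.

Lemma germ_surj (x : reduced_product) : exists s, x = germ s.
Proof. by exists (repr x); rewrite /germ reprK. Qed.

Lemma repr_germ s : exists N, forall n, N <= n -> repr (germ s) n = s n.
Proof. by apply/germP; rewrite /germ reprK. Qed.

Definition rp_mul (x y : reduced_product) :=
  germ (fun n => repr x n * repr y n).
Definition rp_one := germ (fun n => 1).
Definition rp_inv (x : reduced_product) := germ (fun n => (repr x n)^-1).

Lemma rp_mulE s t : rp_mul (germ s) (germ t) = germ (fun n => s n * t n).
Proof.
have [[M e] [N e']] := (repr_germ s, repr_germ t); apply/germP.
by exists (maxn M N) => n; rewrite geq_max => /andP[/e-> /e'->].
Qed.

Lemma rp_invE s : rp_inv (germ s) = germ (fun n => (s n)^-1).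
Proof. by have [N e] := repr_germ s; apply/germP; exists N => n /e->. Qed.

Fact rp_mulA : associative rp_mul.
Proof.
move=> x y z; have [[s ->] [t ->] [u ->]] :=
  And3 (germ_surj x) (germ_surj y) (germ_surj z).
by rewrite !rp_mulE; apply/germP; exists 0 => n _; rewrite mulgA.
Qed.

Fact rp_mul1 : left_id rp_one rp_mul.
Proof.
move=> x; have [s ->] := germ_surj x.
by rewrite rp_mulE; apply/germP; exists 0 => n _; rewrite mul1g.
Qed.

Fact rp_mulr1 : right_id rp_one rp_mul.
Proof.
move=> x; have [s ->] := germ_surj x.
by rewrite rp_mulE; apply/germP; exists 0 => n _; rewrite mulg1.
Qed.

Fact rp_mulV : left_inverse rp_one rp_inv rp_mul.
Proof.
move=> x; have [s ->] := germ_surj x.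
by rewrite rp_invE rp_mulE; apply/germP; exists 0 => n _; rewrite mulVg.
Qed.

Fact rp_mulrV : right_inverse rp_one rp_inv rp_mul.
Proof.
move=> x; have [s ->] := germ_surj x.
by rewrite rp_invE rp_mulE; apply/germP; exists 0 => n _; rewrite mulgV.
Qed.

HB.instance Definition _ := isGroup.Build reduced_product
  rp_mulA rp_mul1 rp_mulr1 rp_mulV rp_mulrV.

Lemma germM s t : germ s * germ t = germ (fun n => s n * t n).
Proof. exact: rp_mulE. Qed.

Lemma germV s : (germ s)^-1 = germ (fun n => (s n)^-1).
Proof. exact: rp_invE. Qed.

End ReducedProduct.

Lemma thread_exists (T : nat -> groupType) (i : forall n, T n -> T n.+1) n
    (x : T n) :
  exists s : forall k, T k, s n = x /\ forall k, n <= k -> s k.+1 = i k (s k).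
Proof.
elim: n T i x => [|n IHn] T i x.
  by exists (fun k => nat_rect (fun k => T k) x i k).
have [s [sn sk]] := IHn (fun k => T k.+1) (fun k => i k.+1) x.
exists (fun k => if k is m.+1 then s m else 1); split=> // -[//|k].
exact: sk.
Qed.

Section DirectedUnion.
Variables (Gm : groupType) (T : nat -> lf_action Gm).
Variable i : forall n, T n -> T n.+1.
Hypothesis iM : forall n, {morph @i n : x y / x * y}.
Hypothesis iI : forall n, injective (@i n).
Hypothesis iA : forall n c x, i (lf_act c x) = lf_act c (i x) :> T n.+1.

Let Q := reduced_product (fun n => lf_group (T n)).
Implicit Types s t : forall n, T n.

Definition coherent n s : Prop := forall k, n <= k -> s k.+1 = i (s k).

Lemma coherent_le m n s : m <= n -> coherent m s -> coherent n s.
Proof. by move=> mn cs k nk; apply: cs; exact: leq_trans nk. Qed.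

Lemma coherent_mul n s t :
  coherent n s -> coherent n t -> coherent n (fun k => s k * t k).
Proof. by move=> cs ct k nk; rewrite cs// ct// iM. Qed.

Lemma coherent_act n c s :
  coherent n s -> coherent n (fun k => lf_act c (s k)).
Proof. by move=> cs k nk; rewrite cs// iA. Qed.

Lemma coherent_inv n s : coherent n s -> coherent n (fun k => (s k)^-1).
Proof.
move=> cs k nk; rewrite cs//; apply: (mulgI (i (s k))); rewrite -iM !mulgV.
by apply/esym/(mulgI (i 1)); rewrite -iM !mulg1.
Qed.

Lemma coherent_eq m n s t : m <= n -> coherent m s -> coherent m t ->
  s m = t m -> s n = t n.
Proof.
move=> /subnK <- cs ct e; elim: (n - m)%N => [//|k IHk].
by rewrite cs ?ct ?IHk// leq_addl.
Qed.

Lemma coherent_inj m n s t : m <= n -> coherent m s -> coherent m t ->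
  s n = t n -> s m = t m.
Proof.
move=> /subnK <- cs ct; elim: (n - m)%N => [//|k IHk].
by rewrite cs ?ct ?leq_addl// => /iI.
Qed.

(** Equality at one level propagates: upwards because both sequences follow the
    embeddings, downwards because the embeddings are injective. *)
Lemma coherent_germ m s t : coherent m s -> coherent m t ->
  germ s = germ t :> Q <-> s m = t m.
Proof.
move=> cs ct; split=> [/germP[N e]|e]; last first.
  by apply/germP; exists m => n mn; exact: (coherent_eq mn).
apply: (coherent_inj (leq_maxl m N) cs ct); apply: e; exact: leq_maxr.
Qed.

Definition union_set : set Q :=
  [set x | exists n s, coherent n s /\ x = germ s].

Lemma union_is_subgroup : is_subgroup union_set.
Proof.
apply/is_subgroupP; split.
- exists 0, (fun n => 1); split=> // k _.
  by apply: (mulgI (i 1)); rewrite -iM !mulg1.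
- move=> _ _ [m [s [cs ->]]] [n [t [ct ->]]].
  exists (maxn m n), (fun k => s k * t k); split; last exact: germM.
  apply: coherent_mul.
    exact: coherent_le (leq_maxl m n) cs.
  exact: coherent_le (leq_maxr m n) ct.
- move=> _ [m [s [cs ->]]].
  by exists m, (fun k => (s k)^-1); split; [exact: coherent_inv|exact: germV].
Qed.

Definition union_group : groupType := subgroup_type union_is_subgroup.

Lemma union_surj (x : union_group) :
  exists n s, coherent n s /\ val x = germ s.
Proof. exact: (set_mem (subgroup_valP x)). Qed.

Lemma inclusion_subproof n (x : T n) :
  exists y : union_group, exists s,
    [/\ coherent n s, s n = x & val y = germ s].
Proof.
have [s [sn cs]] := thread_exists i x.
have gs : (germ s : Q) \in union_set by apply/mem_set; exists n, s.
by exists (SubgroupCarrier gs), s.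
Qed.

Definition inclusion n (x : T n) : union_group :=
  projT1 (cid (inclusion_subproof x)).

Lemma inclusionP n (x : T n) :
  exists s, [/\ coherent n s, s n = x & val (inclusion x) = germ s].
Proof. exact: projT2 (cid (inclusion_subproof x)). Qed.

Lemma inclusion_germ n s (x : union_group) :
  coherent n s -> val x = germ s -> x = inclusion (s n).
Proof.
move=> cs xs; have [t [ct tn e]] := inclusionP (s n); apply: val_inj.
by rewrite e xs; apply/(coherent_germ cs ct).
Qed.

Lemma inclusionM n : {morph @inclusion n : x y / x * y}.
Proof.
move=> x y; have [s [cs <- es]] := inclusionP x.
have [t [ct <- et]] := inclusionP y; apply/esym.
apply: (inclusion_germ (coherent_mul cs ct)).
by rewrite valM es et germM.
Qed.

Lemma inclusion_inj n : injective (@inclusion n).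
Proof.
move=> x y; have [s [cs <- es]] := inclusionP x.
have [t [ct <- et]] := inclusionP y => /(congr1 val).
by rewrite es et => /(coherent_germ cs ct).
Qed.

Lemma inclusionS n (x : T n) : inclusion (i x) = inclusion x.
Proof.
have [s [cs sn es]] := inclusionP x; apply/esym.
rewrite -sn -cs//; apply: inclusion_germ; last by rewrite sn.
exact: coherent_le cs.
Qed.

Lemma inclusion_surj (x : union_group) : exists n y, x = @inclusion n y.
Proof.
have [n [s [cs xs]]] := union_surj x.
by exists n, (s n); exact: inclusion_germ.
Qed.

Lemma inclusion_le m n (x : T m) : m <= n ->
  exists y : T n, inclusion y = inclusion x.
Proof.
move=> /subnK <-; elim: (n - m)%N => [|k [y <-]]; first by exists x.
by exists (i y); exact: inclusionS.
Qed.

(** An element is first written as the image of an element of some T n;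
    [union_actE] shows that any choice gives the same result. *)
Definition union_act c (x : union_group) : union_group :=
  let y := projT2 (cid (inclusion_surj x)) in
  inclusion (lf_act c (projT1 (cid y))).

Lemma union_actE c n (x : T n) :
  union_act c (inclusion x) = inclusion (lf_act c x).
Proof.
rewrite /union_act; case: cid => m /= e; case: cid => y /= {e} xy.
have [s [cs sn es]] := inclusionP x; have [t [ct tm et]] := inclusionP y.
have [s' [cs' sn' es']] := inclusionP (lf_act c x).
have [t' [ct' tm' et']] := inclusionP (lf_act c y).
apply: val_inj; rewrite es' et'.
have st : germ s = germ t :> Q by rewrite -es -et xy.
have -> : germ s' = germ (fun k => lf_act c (s k)) :> Q.
  by apply/(coherent_germ cs' (coherent_act c cs)); rewrite sn' sn.
have -> : germ t' = germ (fun k => lf_act c (t k)) :> Q.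
  by apply/(coherent_germ ct' (coherent_act c ct)); rewrite tm' tm.
by have /germP[N e] := st; apply/germP; exists N => k /e->.
Qed.

Lemma union_common_level (s : seq union_group) :
  exists n, forall x, x \in s -> exists y : T n, x = inclusion y.
Proof.
elim: s => [|x s [n IHs]]; first by exists 0.
have [m [y ->]] := inclusion_surj x; exists (maxn m n) => z.
rewrite inE => /predU1P[->|/IHs[u ->]].
  by have [v <-] := inclusion_le y (leq_maxl m n); exists v.
by have [v <-] := inclusion_le u (leq_maxr m n); exists v.
Qed.

Lemma union_actP : is_action union_act.
Proof.
split=> [x|c d x|c x y].
- have [n [y ->]] := inclusion_surj x.
  by rewrite union_actE (act1 (lf_actP _)).
- have [n [y ->]] := inclusion_surj x.
  by rewrite !union_actE (actM (lf_actP _)).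
- have [n xy] := union_common_level [:: x; y].
  have [u ->] := xy x (mem_head _ _).
  have [|v ->] := xy y; first by rewrite !inE eqxx orbT.
  by rewrite -inclusionM !union_actE (act_morph (lf_actP _)) inclusionM.
Qed.

Lemma union_countable : countable [set: union_group].
Proof.
apply: (@sub_countable _ _ _ (\bigcup_n range (@inclusion n))).
  apply: subset_card_le => x _; have [n [y ->]] := inclusion_surj x.
  by exists n => //; exists y.
apply: bigcup_countable => // n _.
by apply: sub_countable (lf_countable (T n)); exact: card_image_le.
Qed.

Lemma union_locally_finite : locally_finite union_group.
Proof.
apply/locally_finiteP => X /finite_seqP[s Xs].
have [n sn] := union_common_level s.
have /choice[p pP] : forall x, exists y : T n, X x -> x = inclusion y.
  move=> x; have [|nXx] := pselect (X x); last by exists 1.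
  by rewrite Xs => /sn[y ->]; exists y.
have /locally_finiteP lfT := @lf_locally_finite _ (T n).
have [|F [gF finF XF]] := lfT (p @` X).
  by apply: finite_image; rewrite Xs; exact: finite_seq.
have finF' : finite_set (@inclusion n @` F) by exact: finite_image.
exists (@inclusion n @` F); split=> //; last first.
  by move=> x Xx; exists (p x); [apply: XF; exists x|rewrite -pP].
have /is_subgroupP[F1 FM _] := gF; apply: finite_submonoid_subgroup => //.
  exists 1 => //; apply: (mulgI (@inclusion n 1)).
  by rewrite -inclusionM !mulg1.
move=> _ _ [x Fx <-] [y Fy <-]; exists (x * y); first exact: FM.
exact: inclusionM.
Qed.

Definition directed_union : lf_action Gm :=
  LfAction union_actP union_countable union_locally_finite.

(** A partial isomorphism is finite, hence already lives in some T n, where the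
    next group contains a conjugating element for it. *)
Lemma directed_union_homogeneous :
  (forall n (R : set (T n * T n)), partial_iso R ->
    exists g, forall x y, R (x, y) -> i y = i x ^ g) ->
  homogeneous directed_union.
Proof.
move=> iC R pR; have [r Rr] := (finite_seqP R).1 (piso_finite pR).
have [n rn] := union_common_level (map fst r ++ map snd r).
pose R' : set (T n * T n) := [set p | R (inclusion p.1, inclusion p.2)].
have inc1 : @inclusion n 1 = 1.
  by apply: (mulgI (@inclusion n 1)); rewrite -inclusionM !mulg1.
have [|g gP] := iC n R'.
  have finR' : finite_set R'.
    apply: (@finite_preimage _ _ R (fun p => (inclusion p.1, inclusion p.2))).
      by move=> [x y] [x' y'] _ _ /= [] /inclusion_inj-> /inclusion_inj->.
    exact: piso_finite pR.
  split=> //.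
  - apply: finite_submonoid_subgroup => //; rewrite /R' /=.
      by rewrite inc1; exact: piso1 pR.
    by move=> [x y] [x' y'] /=; rewrite !inclusionM; exact: (pisoM pR).
  - by move=> y; rewrite /R' /= inc1 => /(piso_fun pR); rewrite -inc1 => /inclusion_inj.
  - by move=> x; rewrite /R' /= inc1 => /(piso_inj pR); rewrite -inc1 => /inclusion_inj.
exists (inclusion g) => x y Rxy.
have [|u xu] := rn x.
  rewrite mem_cat; apply/orP; left; apply/mapP; exists (x, y) => //.
  by move: Rxy; rewrite Rr.
have [|v yv] := rn y.
  rewrite mem_cat; apply/orP; right; apply/mapP; exists (x, y) => //.
  by move: Rxy; rewrite Rr.
have : i v = i u ^ g by apply: gP; rewrite /R' /= -xu -yv.
move=> /(congr1 (@inclusion n.+1)); rewrite xu yv [in LHS]inclusionS => ->.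
apply: (mulgI (inclusion g)).
by rewrite -inclusionM -!conjgC inclusionM inclusionS.
Qed.

End DirectedUnion.

(** * Extending actions to Hall's group *)

(** Iterate [extension] and take the union. *)
Theorem action_on_homogeneous_extension (Gm : groupType) (E : lf_action Gm) :
  exists (L : lf_action Gm) (j : E -> L),
    [/\ {morph j : x y / x * y}, injective j,
        forall c x, j (lf_act c x) = lf_act c (j x) & homogeneous L].
Proof.
pose T n : lf_action Gm := iter n (@extension Gm) E.
pose i n : T n -> T n.+1 := @extension_embed Gm (T n).
have iM n : {morph i n : x y / x * y} by exact: extension_embedM.
have iI n : injective (i n) by exact: extension_embed_inj.
have iA n c x : i n (lf_act c x) = lf_act c (i n x).
  exact: extension_embed_act.
exists (directed_union iM iI iA), (@inclusion _ _ _ iM 0); split.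
- exact: (inclusionM iM iI (n := 0)).
- exact: (@inclusion_inj _ _ _ iM iI 0).
- by move=> c x; rewrite -(union_actE iM iI iA).
- apply: directed_union_homogeneous => n R pR.
  exact: extension_embed_conj.
Qed.

Lemma embeds_finite_hom (G H : groupType) (j : G -> H) :
  {morph j : x y / x * y} -> injective j -> embeds_finite G -> embeds_finite H.
Proof.
move=> jM jI embG K; have [f fI] := embG K.
have fM : {morph j \o f : x y / x * y} by move=> x y /=; rewrite gmulfM jM.
exists (HB.pack_for {multiplicative K -> H} (j \o f) (isMultiplicative.Build _ _ (j \o f) fM)) => /=.
exact: inj_comp.
Qed.

Section Product.
Variables (Gm : groupType) (E : lf_action Gm) (H : groupType).
Hypotheses (cH : countable [set: H]) (lfH : locally_finite H).
Local Notation EH := (E * H)%type.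

Definition prod_act c (p : EH) : EH := (lf_act c p.1, p.2).

Lemma prod_actP : is_action prod_act.
Proof.
split=> [[x h]|c d [x h]|c [x h] [x' h']].
- by rewrite /prod_act (act1 (lf_actP _)).
- by rewrite /prod_act (actM (lf_actP _)).
- by congr (_, _); exact: (act_morph (lf_actP _)).
Qed.

Lemma prod_countable : countable [set: EH].
Proof. by rewrite -setXTT; apply: countableX => //; exact: lf_countable. Qed.

Lemma prod_locally_finite : locally_finite EH.
Proof.
apply/locally_finiteP => X finX.
have /locally_finiteP lfE' := @lf_locally_finite _ E.
have /locally_finiteP lfH' := lfH.
have [|F [gF finF XF]] := lfE' (fst @` X); first exact: finite_image.
have [|F' [gF' finF' XF']] := lfH' (snd @` X); first exact: finite_image.
exists (F `*` F'); split; last by move=> x Xx; split; [apply: XF|apply: XF']; exists x.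
  have /is_subgroupP[F1 FM FV] := gF; have /is_subgroupP[F1' FM' FV'] := gF'.
  apply/is_subgroupP; split=> [//|[x h] [x' h'] [/= ? ?] [/= ? ?]|[x h] [/= ? ?]].
    by split; [exact: FM|exact: FM'].
  by split; [exact: FV|exact: FV'].
exact: finite_setX.
Qed.

Definition prod_lf_action : lf_action Gm :=
  LfAction prod_actP prod_countable prod_locally_finite.

End Product.

(** The extension of E * H given by [action_on_homogeneous_extension] satisfies
    the hypotheses of [back_and_forth], so it is a copy of H; the action is
    transported along the isomorphism. *)
Theorem action_extends_to_hall (Gm : groupType) (E : lf_action Gm)
    (H : groupType) : is_hall_universal H ->
  exists (F : {multiplicative Gm -> Aut H}) (j : E -> H),
    [/\ {morph j : x y / x * y}, injective j &
        forall c x, j (lf_act c x) = F c (j x)].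
Proof.
move=> hallH; have [cH lfH embH _] := hallH.
have [L [i [iM iI iA homL]]] :=
  action_on_homogeneous_extension (prod_lf_action E cH lfH).
have embL : embeds_finite L.
  apply: (@embeds_finite_hom _ _ (fun h => i (1, h))) embH => [x y|x y].
    by rewrite -iM; congr (i (_, _)); rewrite mulg1.
  by move/iI => [].
have [f [[g fK gK] fM]] := back_and_forth (lf_countable L)
  (@lf_locally_finite _ L) homL embL cH lfH (hall_homogeneous hallH) embH.
pose a c (x : H) : H := f (lf_act c (g x)).
have aM c d x : a (c * d) x = a c (a d x).
  by rewrite /a fK (actM (lf_actP L)).
have a1 x : a 1 x = x by rewrite /a (act1 (lf_actP L)).
have aK c : cancel (a c) (a c^-1) by move=> x; rewrite -aM mulVg.
have aKV c : cancel (a c^-1) (a c) by move=> x; rewrite -aM mulgV.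
have amorph c : is_automorphism (MkSym (Bijective (aK c) (aKV c))).
  apply/asboolP => x y /=; rewrite /a -fM -(act_morph (lf_actP L)).
  congr (f (lf_act c _)); apply: (can_inj fK).
  by rewrite fM !gK.
pose F c : Aut H := MkAut (amorph c).
have FM : {morph F : c d / c * d}.
  by move=> c d; apply: val_inj; apply: symP => x; exact: aM.
exists (HB.pack_for {multiplicative Gm -> Aut H} F (isMultiplicative.Build _ _ F FM)).
exists (fun x => f (i (x, 1))); split.
- by move=> x y; rewrite -fM -iM; congr (f (i (_, _))); rewrite mulg1.
- by move=> x y /(can_inj fK)/iI [].
- by move=> c x /=; rewrite /a fK -iA.
Qed.

(** * Permutations of the natural numbers acting on Hall's group *)

Section FiniteSets.
Local Open Scope fset_scope.

(** A direct sum of countably many groups of order 2, with the singletons as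
    a basis. *)
Definition finite_subsets := {fset nat}.

HB.instance Definition _ := Countable.on finite_subsets.

Implicit Types A B C : finite_subsets.

Definition symdiff A B : finite_subsets := (A `\` B) `|` (B `\` A).

Lemma in_symdiff A B n : (n \in symdiff A B) = (n \in A) (+) (n \in B).
Proof. by rewrite !inE; do 2 case: (n \in _). Qed.

Fact symdiffA : associative symdiff.
Proof. by move=> A B C; apply/fsetP => n; rewrite !in_symdiff addbA. Qed.

Fact symdiff0 : left_id fset0 symdiff.
Proof. by move=> A; apply/fsetP => n; rewrite in_symdiff inE. Qed.

Fact symdiffr0 : right_id fset0 symdiff.
Proof. by move=> A; apply/fsetP => n; rewrite in_symdiff inE addbF. Qed.

Fact symdiffV : left_inverse (fset0 : finite_subsets) id symdiff.
Proof. by move=> A; apply/fsetP => n; rewrite in_symdiff inE addbb. Qed.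

HB.instance Definition _ := isGroup.Build finite_subsets
  symdiffA symdiff0 symdiffr0 symdiffV symdiffV.

Definition image_act (s : Sym nat) A : finite_subsets := [fset s x | x in A].

Lemma in_image_act s A n : (n \in image_act s A) = ((s^-1)%g n \in A).
Proof.
by rewrite -{1}(symKV s n) mem_imfset//; exact: (can_inj (symK s)).
Qed.

Lemma image_actP : is_action image_act.
Proof.
split=> [A|s t A|s A B]; apply/fsetP => n.
- by rewrite in_image_act invg1.
- by rewrite !in_image_act invgM.
- by rewrite in_symdiff !in_image_act in_symdiff.
Qed.

Lemma finite_subsets_locally_finite : locally_finite finite_subsets.
Proof.
apply/locally_finiteP => X /finite_seqP[s Xs].
pose U := \bigcup_(A <- s) A.
exists [set A | A `<=` U]; split.
- apply/is_subgroupP; split=> /= [|A B AU BU|//]; first exact: fsub0set.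
  apply/fsubsetP => n; rewrite in_symdiff.
  have [nA _|_] := boolP (n \in A); first exact: (fsubsetP AU).
  by rewrite addFb; exact: (fsubsetP BU).
- apply: (@sub_finite_set _ _ [set` fpowerset U]); last exact: finite_fset.
  by move=> A /= AU; rewrite fpowersetE.
- by move=> A; rewrite Xs /= => As; exact: bigfcup_sup.
Qed.

Definition finite_subsets_action : lf_action (Sym nat) :=
  LfAction image_actP (countableP _) finite_subsets_locally_finite.

End FiniteSets.

Theorem corollary5 (H : groupType) (hallH : is_hall_universal H) :
  (exists f : {multiplicative Sym nat -> Aut H}, injective f) /\
  (exists S : set H, infinite_set S /\
     forall sigma : H -> H, set_bij S S sigma ->
       exists h : Aut H, forall s : H, S s -> h s = sigma s).
Proof.
have [F [j [_ jI jF]]] := action_extends_to_hall finite_subsets_action hallH.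
pose pt n : H := j [fset n]%fset.
have ptI : injective pt by move=> m n /jI/fset1_inj.
have ptF s n : F s (pt n) = pt (s n).
  by rewrite -jF; congr j; rewrite /= /image_act imfset_fset1.
split; first exists F.
  move=> s t Fst; apply: symP => n; apply: ptI.
  by rewrite -!ptF Fst.
exists (range pt); split.
  move=> finS; apply: infinite_nat.
  rewrite (_ : setT = pt @^-1` range pt); last first.
    by apply/seteqP; split=> n // _; exists n.
  by apply: finite_preimage finS => m n _ _; exact: ptI.
move=> sigma [sS sI sO].
have /choice[u uP] n : exists m, pt m = sigma (pt n).
  by have [|m _ <-] := sS (pt n); [exists n|exists m].
have /choice[v vP] n : exists m, sigma (pt m) = pt n.
  by have [|_ [m _ <-] e] := sO (pt n); [exists n|exists m].
have uK : cancel u v.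
  move=> n; apply: ptI; apply: sI; rewrite ?inE; [by exists (v (u n))|by exists n|].
  by rewrite vP uP.
have vK : cancel v u by move=> n; apply: ptI; rewrite uP vP.
exists (F (MkSym (Bijective uK vK))) => _ [n _ <-].
by rewrite ptF /= uP.
Qed.
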